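(* Let $k\geq 2$ and $n \geq 3(k-1)$ be integers. If $D$ is a digraph of order $n$ that contains no $k$-strongly connected subdigraph, then $$|A(D)|\leq\binom{n-k+1}{2}+\frac{17}{6}(k-1)(n-k+1).$$
   Context: All digraphs are finite and strict (no loops, no parallel arcs; a pair of opposite arcs $(u,v),(v,u)$ is allowed). $V(D)$ and $A(D)$ denote the vertex set and arc set of $D$; the order of $D$ is $|V(D)|$. A digraph is strongly connected if for every pair of distinct vertices $u,v$ there are both a directed path from $u$ to $v$ and one from $v$ to $u$. A separator of $D$ is a set $S\subseteq V(D)$ such that $D-S$ is not strongly connected or is trivial (a single vertex). The vertex-strong connectivity $\kappa(D)$ is the minimum cardinality of a separator of $D$. $D$ is $k$-strongly connected if $\kappa(D)\ge k$ (in particular, a $k$-strongly connected digraph has at least $k+1$ vertices). *)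

(* Defs.v *)
From mathcomp Require Import all_boot all_order all_algebra.

Set Implicit Arguments.
Unset Strict Implicit.
Unset Printing Implicit Defensive.

(* Finite strict digraphs whose vertices are drawn from an ambient finite type
   [T], so that a digraph and its subdigraphs have the same Rocq type. An arc
   from [u] to [v] is the ordered pair [(u, v)]. *)
Record digraph (T : finType) := Digraph {
  vset : {set T};
  arcset : {set T * T};
  arcset_strict :
    {in arcset, forall a, [/\ a.1 \in vset, a.2 \in vset & a.1 != a.2]} }.

Section Digraphs.

Variable T : finType.
Implicit Types (D H : digraph T) (S : {set T}).

Definition order_of D : nat := #|vset D|.

Definition arc D : rel T := [rel u v | (u, v) \in arcset D].

Definition subdigraph H D : bool :=
  (vset H \subset vset D) && (arcset H \subset arcset D).

Definition del_arcs D S : {set T * T} :=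
  [set a in arcset D | (a.1 \notin S) && (a.2 \notin S)].

Lemma del_arcs_strict D S :
  {in del_arcs D S, forall a,
    [/\ a.1 \in vset D :\: S, a.2 \in vset D :\: S & a.1 != a.2]}.
Proof.
move=> a; rewrite inE => /andP[/arcset_strict[a1D a2D neq_a] /andP[a1S a2S]].
by rewrite !inE a1S a2S.
Qed.

Definition del_vertices D S : digraph T := Digraph (@del_arcs_strict D S).

(* Both directions are covered, since [(u, v)] ranges over ordered pairs. *)
Definition strongly_connected D : bool :=
  [forall u in vset D, forall v in vset D, (u != v) ==> connect (arc D) u v].

(* The digraph without vertices is counted as trivial; this only makes
   [vset D] a separator of [D], and the minimum below is not affected unless
   [D] itself has no vertices, in which case it is 0. *)
Definition trivial_digraph D : bool := order_of D <= 1.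

Definition separator D S : bool :=
  (S \subset vset D) &&
  (~~ strongly_connected (del_vertices D S)
   || trivial_digraph (del_vertices D S)).

Lemma separator_vset D : separator D (vset D).
Proof.
rewrite /separator subxx /=; apply/orP; right.
by rewrite /trivial_digraph /order_of /= setDv cards0.
Qed.

(* [vset D] is only the default witness that [arg min] asks for. *)
Definition kappa D : nat :=
  #|[arg min_(S < vset D | separator D S) #|S| ]|.

Lemma kappa_min D :
  (exists2 S, separator D S & kappa D = #|S|) /\
  (forall S, separator D S -> kappa D <= #|S|).
Proof.
rewrite /kappa; case: arg_minnP => [|S sepS minS]; first exact: separator_vset.
by split; [exists S | move=> S' /minS].
Qed.

Definition k_strongly_connected (k : nat) D : bool := k <= kappa D.

Lemma k_strongly_connected_order k D :
  0 < k -> k_strongly_connected k D -> k < order_of D.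
Proof.
rewrite /k_strongly_connected => k_gt0 lekD.
have [_ minD] := kappa_min D.
have := minD _ (separator_vset D).
have [-> |[x xD] _] := set_0Vmem (vset D).
  by rewrite cards0 leqn0 => /eqP kD; move: lekD; rewrite kD leqNgt k_gt0.
rewrite /order_of (cardsD1 x) xD add1n ltnS (leq_trans lekD) // minD //.
rewrite /separator subsetDl /trivial_digraph /order_of /=; apply/orP; right.
rewrite -(cards1 x) subset_leq_card //; apply/subsetP=> y.
by rewrite !inE negb_and negbK => /andP[/orP[//|/negbTE->]].
Qed.

End Digraphs.

(* Main.v *)
(* Call two vertices adjacent when they span a 2-cycle. Since
   [2 |A(D)| <= n (n - 1) + p], where [p] counts the ordered adjacent pairs, it
   is enough to bound [p]. With [m = k - 1], every set [U] of [m + x] vertices,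
   [x >= 2], splits into [A], [B] and a separator of size [m] with no adjacent
   pair between [A] and [B]. Deleting the smaller side repeatedly shows that
   [U] has at least [(x^2 - 1) / 3] nonadjacent unordered pairs. The
   resulting quadratic bound on the adjacent unordered pairs lies below the
   linear one, [11/6 m x - m (m - 1) / 2], for [2 m <= x <= 3 m]; from there on
   the linear bound propagates along the splittings. *)
Require Import Defs.
From mathcomp Require Import all_boot all_order all_algebra.
From mathcomp Require Import zify lra.

Set Implicit Arguments.
Unset Strict Implicit.
Unset Printing Implicit Defensive.

(** * Finite sets: subsets of given size and off-diagonal pairs *)

Lemma exists_subset_card (T : finType) (A : {set T}) i :
  i <= #|A| -> exists2 B : {set T}, B \subset A & #|B| = i.
Proof.
case/card_geqP=> s [uniq_s size_s sub_s]; exists [set x in s].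
  by apply/subsetP=> x; rewrite inE => /sub_s.
by rewrite cardsE; move/card_uniqP: uniq_s => ->.
Qed.

Lemma exists_addends a b t : 0 < a -> 0 < b -> 1 < t <= a + b ->
  exists i j, [/\ 0 < i <= a, 0 < j <= b & i + j = t].
Proof.
by move=> *; exists (minn a t.-1), (t - minn a t.-1); split; lia.
Qed.

Definition offdiag (T : finType) (A : {set T}) : {set T * T} :=
  [set a | [&& a.1 \in A, a.2 \in A & a.1 != a.2]].

Lemma card_offdiag (T : finType) (A : {set T}) :
  #|offdiag A| + #|A| = #|A| * #|A|.
Proof.
rewrite -cardsX -(cardsID [set a : T * T | a.1 == a.2] (setX A A)) addnC.
congr addn.
  have inj_diag : injective (fun x : T => (x, x)) by move=> x y [].
  rewrite -(card_imset A inj_diag); apply: eq_card => -[x y].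
  rewrite !inE /=; apply/imsetP/idP.
    by case=> z zA [-> ->]; rewrite zA eqxx.
  by case/andP=> /andP[xA _] /eqP <-; exists x.
by apply: eq_card => -[x y]; rewrite !inE /=; case: (x == y);
  rewrite ?andbF ?andbT.
Qed.

(** * Counting related pairs through separations *)

Section SymmetricPairs.

Variables (T : finType) (r : rel T).
Hypotheses (r_sym : symmetric r) (r_irr : irreflexive r).
Implicit Types A B U : {set T}.

Definition rpairs U : {set T * T} :=
  [set a | [&& a.1 \in U, a.2 \in U & r a.1 a.2]].

(** The separator is [U :\: A :\: B]; the last condition gives it exactly [m] elements. *)
Definition separated m U A B :=
  [/\ A \subset U, B \subset U :\: A, {in A & B, forall x y, ~~ r x y}
    & #|A| + #|B| + m = #|U|].

Definition splits m U :=
  exists A B, 0 < #|A| <= #|B| /\ separated m U A B.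

Lemma card_rpairs U : #|rpairs U| + #|U| <= #|U| * #|U|.
Proof.
rewrite -card_offdiag leq_add2r; apply/subset_leq_card/subsetP=> -[x y].
rewrite !inE /= => /and3P[-> -> rxy] /=.
by apply: contraTneq rxy => ->; rewrite r_irr.
Qed.

Lemma separated_card m U A B : separated m U A B ->
  [/\ #|U :\: A| = m + #|B|, #|U :\: B| = m + #|A|
    & #|U :\: A :\: B| = m].
Proof.
case=> sAU sBU _ cardU.
have sBU' : B \subset U by apply: subset_trans sBU (subsetDl _ _).
rewrite !cardsDS //; split; lia.
Qed.

(** A related pair meeting [A] lies inside [A] or joins [A] to the separator, in one of two
    orders. *)
Lemma separated_peel m U A B : separated m U A B ->
  #|rpairs U| + #|A| <= #|rpairs (U :\: A)| + #|A| * #|A| + 2 * (#|A| * m).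
Proof.
move=> sepU; have [_ _ cardS] := separated_card sepU.
case: sepU => _ _ nr _; set S := U :\: A :\: B in cardS.
have sub : rpairs U \subset
    rpairs (U :\: A) :|: (offdiag A :|: (setX A S :|: setX S A)).
  apply/subsetP=> -[x y]; rewrite !inE /= => /and3P[xU yU rxy].
  rewrite xU yU rxy /=.
  have nxy : x != y by apply: contraTneq rxy => ->; rewrite r_irr.
  rewrite nxy; case xA: (x \in A); case yA: (y \in A) => //=.
    by rewrite !andbF orbF andbT; apply: contraTN rxy => yB; apply: nr.
  by rewrite !andbT; apply: contraTN rxy; rewrite r_sym => xB; apply: nr.
have := subset_leq_card sub; have := card_offdiag A.
have := leq_of_leqif (leq_card_setU (setX A S) (setX S A)).
have := leq_of_leqif (leq_card_setU (offdiag A) (setX A S :|: setX S A)).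
have := leq_of_leqif (leq_card_setU (rpairs (U :\: A))
  (offdiag A :|: (setX A S :|: setX S A))).
rewrite !cardsX cardS (mulnC m).
move: #|rpairs U| #|_ :|: (offdiag _ :|: _)| #|offdiag A :|: _|
  #|setX A S :|: _| #|offdiag A| => p q s t o; lia.
Qed.

(** A related pair cannot meet both [A] and [B], so it survives the deletion of one of them. *)
Lemma separated_glue m U A B : separated m U A B ->
  #|rpairs U| <= #|rpairs (U :\: A)| + #|rpairs (U :\: B)|.
Proof.
case=> _ sBU nr _; apply: leq_trans (leq_of_leqif (leq_card_setU _ _)).
apply/subset_leq_card/subsetP=> -[x y]; rewrite !inE /= => /and3P[-> -> rxy].
have notAB u v : u \in A -> v \in B -> r u v -> False.
  by move=> uA vB; apply/negP/nr.
have disAB u : u \in A -> u \in B -> False.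
  by move=> uA /(subsetP sBU); rewrite inE uA.
rewrite rxy !andbT /=; case xA: (x \in A); case yA: (y \in A) => //=;
  case xB: (x \in B); case yB: (y \in B) => //=;
  by [case: (notAB x y) | case: (notAB y x); rewrite // r_sym
     | case: (disAB x) | case: (disAB y)].
Qed.

(* The bound [3 p <= 3 n (n - 1) - 2 (x ^ 2 - 1)], without subtractions. *)
Lemma rpairs_quadratic m U x :
    (forall U', U' \subset U -> m + 2 <= #|U'| -> splits m U') ->
  #|U| = m + x ->
  3 * #|rpairs U| + 2 * (x * x) + 3 * (m + x) <= 3 * ((m + x) * (m + x)) + 2.
Proof.
elim/ltn_ind: x U => x IH U splitU cardU.
have [x_le1 | x_gt1] := leqP x 1.
  have : x * x <= 1 by case: x x_le1 {IH cardU} => [|[]].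
  have := card_rpairs U; rewrite cardU; lia.
have [|A [B [/andP[A_gt0 leAB] sepU]]] := splitU U (subxx U); first by lia.
have [cardDA _ _] := separated_card sepU.
have peel := separated_peel sepU.
case: sepU => _ _ _ cardAB.
have lt_Bx : #|B| < x by lia.
have splitD U' : U' \subset U :\: A -> m + 2 <= #|U'| -> splits m U'.
  by move=> sU'; apply: splitU; apply: subset_trans sU' (subsetDl _ _).
have := IH _ lt_Bx _ splitD cardDA.
have -> : x = #|A| + #|B| by lia.
(* With [a <= b] the sizes of [A] and [B], the [a b] new nonadjacent pairs suffice:
   [(a + b)^2 - b^2 <= 3 a b]. *)
have : #|A| * #|A| <= #|A| * #|B| by rewrite leq_mul2l leAB orbT.
move: peel; lia.
Qed.

(* The bound [p <= 11/3 m x - m (m - 1)], without subtractions. *)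
Lemma rpairs_linear m U x :
    (forall U', U' \subset U -> m + 2 <= #|U'| -> splits m U') ->
  0 < m -> #|U| = m + x -> 2 * m <= x ->
  3 * #|rpairs U| + 3 * (m * m) <= 11 * (m * x) + 3 * m.
Proof.
move=> splitU m_gt0; elim/ltn_ind: x U splitU => x IH U splitU cardU x_ge.
have [x_le | x_gt] := leqP x (3 * m).
  have := rpairs_quadratic splitU cardU.
  (* This is [(x - 2 m) (x - 3 m) <= 0]. *)
  have : x * x + 6 * (m * m) <= 5 * (m * x).
    have [d xE] : exists d, x = 2 * m + d by exists (x - 2 * m); lia.
    have : d * d <= m * d by rewrite leq_mul2r; lia.
    rewrite xE; lia.
  lia.
have [|A [B [/andP[A_gt0 leAB] sepU]]] := splitU U (subxx U); first by lia.
have [cardDA cardDB _] := separated_card sepU.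
have peel := separated_peel sepU.
have glue := separated_glue sepU.
have splitD C U' : U' \subset U :\: C -> m + 2 <= #|U'| -> splits m U'.
  by move=> sU'; apply: splitU; apply: subset_trans sU' (subsetDl _ _).
have quadA := rpairs_quadratic (splitD B) cardDB.
have quadB := rpairs_quadratic (splitD A) cardDA.
case: sepU => _ _ _ cardAB.
have xE : x = #|A| + #|B| by lia.
have lt_Ax : #|A| < x by lia.
have lt_Bx : #|B| < x by lia.
have linA := IH _ lt_Ax (U :\: B) (splitD B) cardDB.
have linB := IH _ lt_Bx (U :\: A) (splitD A) cardDA.
move: #|A| #|B| x #|rpairs U| #|rpairs (U :\: A)| #|rpairs (U :\: B)|
  A_gt0 leAB peel glue quadA quadB linA linB xE x_gt {IH splitU cardU x_ge
  cardDA cardDB splitD cardAB lt_Ax lt_Bx} => a b x p pA pB.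
move=> a_gt0 leab peel glue quadA quadB linA linB -> x_gt.
(* If [b < 2 m], then [a + b > 3 m] puts both sizes between [m] and [2 m], and two quadratic bounds
   are glued. *)
have [b_ge | b_lt] := leqP (2 * m) b; last first.
  have sqr_le c : m <= c <= 2 * m -> c * c + 2 * (m * m) <= 3 * (m * c).
    move=> c_m; have [d cE] : exists d, c = m + d by exists (c - m); lia.
    have : d * d <= m * d by rewrite leq_mul2r; lia.
    rewrite cE; lia.
  have := sqr_le a; have := sqr_le b.
  have : m * (3 * m) <= m * (a + b) by rewrite leq_mul2l; lia.
  lia.
have {}linB := linB b_ge.
have [a_ge | a_lt] := leqP (2 * m) a.
  (* Gluing two linear bounds counts the constant [- m (m - 1) <= 0] twice. *)
  have {}linA := linA a_ge; have := leq_pmulr m m_gt0; lia.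
(* Peeling [A] costs [3 a (a - 1) + 6 a m], which is within the allowance [11 a m] exactly when
   [3 (a - 1) <= 5 m] (for [a > 0]). For larger [a], the quadratic bound on [U :\: B] is glued to
   the linear one on [U :\: A]. *)
have [a_le | a_gt] := leqP (3 * a) (5 * m + 3).
  have : a * (3 * a) <= a * (5 * m + 3) by rewrite leq_mul2l a_le orbT.
  lia.
have : a * a <= a * (2 * m) by rewrite leq_mul2l; lia.
have : m * m <= m * a by rewrite leq_mul2l; lia.
lia.
Qed.

End SymmetricPairs.

(** * The 2-cycles of a digraph *)

Section TwoCycles.

Variables (T : finType) (D : digraph T).

Definition twocycle : rel T := [rel u v | Defs.arc D u v && Defs.arc D v u].

Lemma twocycle_sym : symmetric twocycle.
Proof. by move=> u v; rewrite /twocycle /= andbC. Qed.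

Lemma twocycle_irr : irreflexive twocycle.
Proof.
move=> u; apply/negP=> /andP[/arcset_strict[_ _]].
by rewrite /= eqxx.
Qed.

(** Inclusion-exclusion for the arc set and its reversal, whose intersection consists of the arcs on
    2-cycles. *)
Lemma card_arcset_twocycles :
  2 * #|arcset D| + #|vset D|
    <= #|vset D| * #|vset D| + #|rpairs twocycle (vset D)|.
Proof.
pose swap (a : T * T) := (a.2, a.1).
have swapK : involutive swap by case.
have card_swap : #|swap @: arcset D| = #|arcset D|.
  exact/card_imset/(inv_inj swapK).
have in_swap a : (a \in swap @: arcset D) = (swap a \in arcset D).
  by rewrite -{1}[a]swapK (mem_imset _ _ (inv_inj swapK)).
have subU : arcset D :|: swap @: arcset D \subset offdiag (vset D).
  apply/subsetP=> -[x y]; rewrite !inE in_swap.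
  case/orP=> /arcset_strict[/= -> ->] //=.
  by rewrite eq_sym.
have subI : arcset D :&: swap @: arcset D \subset rpairs twocycle (vset D).
  apply/subsetP=> -[x y]; rewrite !inE in_swap => /andP[xy yx].
  by case/arcset_strict: (xy) => /= -> -> _ /=; apply/andP.
have := cardsUI (arcset D) (swap @: arcset D); rewrite card_swap.
have := subset_leq_card subU; have := subset_leq_card subI.
have := card_offdiag (vset D); lia.
Qed.

Lemma rpairs_twocycle_strict (U : {set T}) :
  {in rpairs twocycle U, forall a, [/\ a.1 \in U, a.2 \in U & a.1 != a.2]}.
Proof.
move=> a; rewrite inE => /and3P[a1U a2U /andP[/arcset_strict[_ _ neq_a] _]].
by split.
Qed.

Lemma twocycle_splits m (U : {set T}) :
    ~ (exists H : digraph T, subdigraph H D /\ k_strongly_connected m.+1 H) ->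
  U \subset vset D -> m + 2 <= #|U| -> splits twocycle m U.
Proof.
move=> hno sUD cardU.
(* All arcs of [H] come in opposite pairs, so a separator of [H] separates the adjacency relation
   itself. *)
pose H := Digraph (@rpairs_twocycle_strict U).
have lt_kappa : kappa H <= m.
  rewrite leqNgt; apply/negP=> kH; apply: hno; exists H; split=> //.
  rewrite /subdigraph sUD; apply/subsetP=> -[x y].
  by rewrite inE => /and3P[_ _ /andP[]].
have [[S /andP[/= sSU sepS] kS] _] := kappa_min H.
have cardUS : #|U :\: S| = #|U| - #|S| by rewrite cardsDS.
(* At least two vertices remain, since [S] has at most [m] and [U] at least [m + 2]. *)
have {sepS} : ~~ strongly_connected (del_vertices H S).
  case/orP: sepS => //; rewrite /trivial_digraph /order_of /= cardUS; lia.
case/forall_inPn=> u uUS /forall_inPn[v vUS].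
rewrite negb_imply => /andP[_ nuv].
pose C := [set w | connect (Defs.arc (del_vertices H S)) u w].
pose A := (U :\: S) :&: C; pose B := (U :\: S) :\: C.
have cardAB : #|A| + #|B| = #|U| - #|S| by rewrite cardsID.
have A_gt0 : 0 < #|A|.
  by apply/card_gt0P; exists u; rewrite !inE in uUS *; rewrite uUS connect0.
have B_gt0 : 0 < #|B|.
  by apply/card_gt0P; exists v; rewrite !inE in vUS *; rewrite vUS nuv.
have nr : {in A & B, forall x y, ~~ twocycle x y}.
  move=> x y; rewrite !inE => /andP[/andP[xS xU] ux] /andP[nuy /andP[yS yU]].
  apply: contra nuy => rxy; apply: connect_trans ux (connect1 _).
  by rewrite /Defs.arc /= !inE /= xU yU xS yS /= -/(twocycle _ _) rxy.
(* The remaining vertices of [A] and [B] join [S], so that it has size [m]. *)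
have [i [j [/andP[i_gt0 le_iA] /andP[j_gt0 le_jB] ij]]] :
    exists i j, [/\ 0 < i <= #|A|, 0 < j <= #|B| & i + j = #|U| - m].
  by apply: exists_addends => //; rewrite cardAB -kS; lia.
have [A' sA' cardA'] := exists_subset_card le_iA.
have [B' sB' cardB'] := exists_subset_card le_jB.
have sAU : A' \subset U.
  by apply: subset_trans sA' (subset_trans (subsetIl _ _) (subsetDl _ _)).
have sBU : B' \subset U.
  by apply: subset_trans sB' (subset_trans (subsetDl _ _) (subsetDl _ _)).
have dis : [disjoint A' & B'].
  apply: disjointWl sA' (disjointWr sB' _).
  by rewrite disjoint_sym -setI_eq0; apply/eqP/setP=> w; rewrite !inE;
    case: connect; rewrite ?andbF.
have nr' : {in A' & B', forall x y, ~~ twocycle x y}.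
  by move=> x y /(subsetP sA') xA /(subsetP sB'); apply: nr.
have cardAB' : #|A'| + #|B'| + m = #|U|.
  by rewrite cardA' cardB' ij subnK // (leq_trans (leq_addr _ _) cardU).
have [leAB | /ltnW leBA] := leqP #|A'| #|B'|.
  exists A', B'; rewrite leAB cardA' i_gt0; split=> //; split=> //.
  by rewrite subsetD sBU disjoint_sym.
exists B', A'; rewrite leBA cardB' j_gt0; split=> //; split=> //.
- by rewrite subsetD sAU.
- by move=> x y xB yA; rewrite twocycle_sym; apply: nr'.
- by rewrite (addnC #|B'|).
Qed.

End TwoCycles.

Theorem theorem4p4 (k n : nat) (hk : 2 <= k) (hn : 3 * (k - 1) <= n)
    (T : finType) (D : digraph T) (hD : order_of D = n)
    (hno : ~ exists H : digraph T, subdigraph H D /\ k_strongly_connected k H) :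
  (#|arcset D|%:R
    <= 'C(n - k + 1, 2)%:R + 17%:R / 6%:R * (k - 1)%:R * (n - k + 1)%:R
    :> rat)%R.
Proof.
pose m := k - 1; pose x := n - k + 1.
have kE : k = m.+1 by lia.
have nE : n = m + x by lia.
have cardV : #|vset D| = m + x by rewrite -nE -hD.
rewrite kE in hno.
have splitV U := twocycle_splits (U := U) hno.
have m_gt0 : 0 < m by lia.
(* This is the hypothesis [3 (k - 1) <= n] rewritten with [n = m + x]. *)
have x_ge : 2 * m <= x by lia.
have lin := rpairs_linear (@twocycle_sym _ D) (@twocycle_irr _ D)
  splitV m_gt0 cardV x_ge.
have := card_arcset_twocycles D; rewrite cardV => arcs.
have bin y : 2 * 'C(y, 2) + y = y * y.
  by case: y => // y; rewrite -mul_bin_diag bin1 /=; lia.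
have {}bin := bin x.
(* The terms [3 m (m - 1)] cancel, and [6 m x] from [3 (m + x)^2] joins [11 m x] to give 17. *)
have main : 6 * #|arcset D| <= 6 * 'C(x, 2) + 17 * (m * x).
  by move: #|arcset D| #|rpairs _ _| lin arcs => d p; lia.
have : ((6 * #|arcset D|)%:R <= (6 * 'C(x, 2) + 17 * (m * x))%:R :> rat)%R.
  by rewrite Num.Theory.ler_nat.
by rewrite (GRing.natrD _ (6 * _)) !GRing.natrM -/m -/x; lra.
Qed.
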